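(* Suppose that there exist solutions $\hat f$, $\hat{\hat f}$, $\hat\Upsilon$ to Poisson's equation (with forcing functions $f$, $\hat f$ and $\Upsilon$ respectively, as defined in the context) that are continuously differentiable on $\Pi=\mathbb{R}^d\times\Omega$. Let $\{\Theta_t\}$ be any solution of the fixed-gain QSA ODE $\frac{d}{dt}\Theta_t=\alpha f(\Theta_t,\xi_t)$ and write $\hat f_t=\hat f(\Theta_t,\Phi_t)$, $\Upsilon_t=\Upsilon(\Theta_t,\Phi_t)$. Then: (i) The process $Y_t=\Theta_t+\alpha\hat f_t$ (so $\Theta_t=Y_t-\alpha\hat f_t$) satisfies $$\frac{d}{dt}Y_t=\alpha\Big[\bar f(Y_t)-\alpha\big(B_t\hat f_t+\Upsilon_t\big)\Big],\qquad B_t=\int_0^1\bar A(Y_t-r\alpha\hat f_t)\,dr .$$ (ii) Define $\mathcal W^0_t=-[D^f\hat\Upsilon](\Theta_t,\Phi_t)$, $\mathcal W^1_t=-[D^f\hat{\hat f}](\Theta_t,\Phi_t)+\hat\Upsilon(\Theta_t,\Phi_t)$, $\mathcal W^2_t=\hat{\hat f}(\Theta_t,\Phi_t)$, and suppose $t\mapsto\mathcal W^1_t$ is differentiable and $t\mapsto\mathcal W^2_t$ is twice differentiable. Then $$\frac{d}{dt}\Theta_t=\alpha\big[\bar f(\Theta_t)-\alpha\bar\Upsilon(\Theta_t)+\mathcal W_t\big],\qquad \mathcal W_t=\alpha^2\mathcal W^0_t+\alpha\frac{d}{dt}\mathcal W^1_t+\frac{d^2}{dt^2}\mathcal W^2_t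 .$$
   Context: Setting. Fix $d,m,K\ge1$, frequencies $\omega_i>0$, phases $\phi_i$. Clock process: $\frac{d}{dt}\Phi_t=W\Phi_t$, $W=2\pi j\,\mathrm{diag}(\omega_i)$, $\Phi^i_t=\exp(2\pi j[\omega_it+\phi_i])$; $\Omega\subset\mathbb{C}^K$ is the closure of its orbit (compact, flow invariant; any point may be used as $\Phi_0$), and $\pi$ is the uniform (Haar) probability measure on $\Omega$. Probing signal $\xi_t=G(\Phi_t)$ with $G(z)=G_0((z+1/z)/2)$, $G_0\colon\mathbb{R}^K\to\mathbb{R}^m$ analytic with absolutely summable Taylor coefficients. $f\colon\mathbb{R}^d\times\mathbb{R}^m\to\mathbb{R}^d$ and $\bar f(\theta)=\int_\Omega f(\theta,G(z))\pi(dz)$ are continuously differentiable, $\bar A(\theta)=\partial_\theta\bar f(\theta)$, and $\alpha>0$. Poisson's equation: for $g\colon\mathbb{R}^d\times\Omega\to\mathbb{R}^d$ with $\bar g(\theta)=\int g(\theta,z)\pi(dz)$, a solution is $\hat g\colon\mathbb{R}^d\times\Omega\to\mathbb{R}^d$ such that for every $\theta$, every initial $\Phi_0\in\Omega$ and all $0\le t_0\le t_1$: $\hat g(\theta,\Phi_{t_0})=\int_{t_0}^{t_1}[g(\theta,\Phi_t)-\bar g(\theta)]dt+\hat g(\theta,\Phi_{t_1})$, normalized so $\int\hat g(\theta,z)\pi(dz)=0$. Here $\hat f$ solves it with forcing $(\theta,z)\mapsto f(\theta,G(z))$; $\hat A(\theta,z)=\partial_\theta\hat f(\theta,z)$; $\Upsilon(\theta,z)=-\hat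 A(\theta,z)f(\theta,G(z))$ and $\bar\Upsilon(\theta)=\int_\Omega\Upsilon(\theta,z)\pi(dz)$; $\hat{\hat f}$ solves Poisson's equation with forcing $\hat f$; $\hat\Upsilon$ solves it with forcing $\Upsilon$. For $h\colon\mathbb{R}^d\times\Omega\to\mathbb{R}^d$ differentiable in $\theta$, $[D^fh](\theta,z)=\partial_\theta h(\theta,z)\,f(\theta,G(z))$. *)

(* Defs.v *)
From HB Require Import structures.
From mathcomp Require Import all_boot all_order all_algebra.
From mathcomp Require Import all_classical all_reals all_analysis.
From mathcomp Require Import complex.
Import numFieldNormedType.Exports.
Import Order.TTheory GRing.Theory Num.Theory.

Set Implicit Arguments.
Unset Strict Implicit.
Unset Printing Implicit Defensive.

Local Open Scope classical_set_scope.
Local Open Scope ring_scope.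

Section qsa.
Variable R : realType.

(* Points of C^K are represented as K-tuples of (real part, imaginary part)
   pairs; this carrier carries the product Borel sigma-algebra of R^(2K). *)
Definition CK (K : nat) := K.-tuple (R * R).

Definition toC (p : R * R) : R[i] := Complex p.1 p.2.

Definition cmul (p q : R * R) : R * R :=
  (p.1 * q.1 - p.2 * q.2, p.1 * q.2 + p.2 * q.1).

Definition expj (x : R) : R * R := (cos (2 * pi * x), sin (2 * pi * x)).

Definition clock K (om ph : 'I_K -> R) (t : R) : CK K :=
  mktuple (fun i => expj (om i * t + ph i)).

(* the flow of d/dt Phi = W Phi started at an arbitrary z : z_i exp(2 pi j omega_i t) *)
Definition flow K (om : 'I_K -> R) (t : R) (z : CK K) : CK K :=
  mktuple (fun i => cmul (tnth z i) (expj (om i * t))).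

Definition Omega K (om ph : 'I_K -> R) : set (CK K) :=
  [set z | forall e : R, 0 < e -> exists t : R, forall i : 'I_K,
     `|(tnth z i).1 - (tnth (clock om ph t) i).1| < e /\
     `|(tnth z i).2 - (tnth (clock om ph t) i).2| < e].

Definition mulCK K (u z : CK K) : CK K := mktuple (fun i => cmul (tnth u i) (tnth z i)).

(* pi is the uniform (Haar) probability on Omega = Phi_0 * H, where
   H = closure of {exp(W t)} (the orbit closure with zero phases) is a
   compact group: pi is carried by Omega and invariant under H. *)
Definition is_haar_on K (om ph : 'I_K -> R) (P : probability (CK K) R) : Prop :=
  P (Omega om ph) = 1%:E /\
  forall u, Omega om (fun=> 0) u -> forall A : set (CK K), measurable A ->
    P (mulCK u @^-1` A) = P A.

(* G(z) = G_0((z + 1/z)/2)   (a real vector on Omega; we take the real part) *)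
Definition Gsig K m (G0 : 'rV[R]_K -> 'rV[R]_m) (z : CK K) : 'rV[R]_m :=
  G0 (\row_i complex.Re ((toC (tnth z i) + (toC (tnth z i))^-1) / 2%:R)).

Definition box_sum K m (c : ('I_K -> nat) -> 'rV[R]_m) (x : 'rV[R]_K) (N : nat) : 'rV[R]_m :=
  \sum_(a : {ffun 'I_K -> 'I_N.+1}) (\prod_i (x 0 i) ^+ (a i)) *: c (fun i => nat_of_ord (a i)).

Definition abs_summable_coef K m (c : ('I_K -> nat) -> 'rV[R]_m) : Prop :=
  exists M : R, forall N : nat,
    \sum_(a : {ffun 'I_K -> 'I_N.+1}) `|c (fun i => nat_of_ord (a i))| <= M.

Definition power_series_abs_summable K m (G0 : 'rV[R]_K -> 'rV[R]_m) : Prop :=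
  exists c : ('I_K -> nat) -> 'rV[R]_m,
    abs_summable_coef c /\
    forall x : 'rV[R]_K, (forall i, `|x 0 i| <= 1) ->
      box_sum c x @ \oo --> G0 x.

(* continuous differentiability on a finite-dimensional normed space:
   all directional derivatives exist and depend continuously on the point *)
Definition C1 (V W : normedModType R) (F : V -> W) : Prop :=
  (forall x v, derivable F x v) /\ (forall v, continuous (fun x => 'D_v F x)).

Definition avg K n (P : probability (CK K) R) (D : set (CK K)) (h : CK K -> 'rV[R]_n)
  : 'rV[R]_n := \row_j Rintegral P D (fun z => h z 0 j).

Definition vint n (a b : R) (h : R -> 'rV[R]_n) : 'rV[R]_n :=
  \row_j Rintegral (@lebesgue_measure R) `[a, b] (fun t => h t 0 j).

Definition poisson_sol K d (om ph : 'I_K -> R) (P : probability (CK K) R)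
  (g gh : 'rV[R]_d -> CK K -> 'rV[R]_d) : Prop :=
  (forall (th : 'rV[R]_d) (z0 : CK K), Omega om ph z0 ->
     forall t0 t1 : R, 0 <= t0 -> t0 <= t1 ->
       gh th (flow om t0 z0) =
         vint t0 t1 (fun t => g th (flow om t z0) - avg P (Omega om ph) (g th))
         + gh th (flow om t1 z0)) /\
  (forall th, avg P (Omega om ph) (gh th) = 0).

Definition distCK K (z w : CK K) : R :=
  \big[Order.max/0]_(i < K)
     Order.max `|(tnth z i).1 - (tnth w i).1| `|(tnth z i).2 - (tnth w i).2|.

Definition cont_Pi K d n (Om : set (CK K)) (H : 'rV[R]_d -> CK K -> 'rV[R]_n) : Prop :=
  forall th z, Om z -> forall e : R, 0 < e -> exists2 del : R, 0 < del &
    forall th' z', Om z' -> `|th' - th| < del -> distCK z' z < del ->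
      `|H th' z' - H th z| < e.

Definition C1_Pi K d (Om : set (CK K)) (h : 'rV[R]_d -> CK K -> 'rV[R]_d) : Prop :=
  cont_Pi Om h /\
  (forall z, Om z -> forall th v, derivable (fun th' => h th' z) th v) /\
  (forall v, cont_Pi Om (fun th z => 'D_v (fun th' => h th' z) th)).

Definition Df K d m (f : 'rV[R]_d -> 'rV[R]_m -> 'rV[R]_d) (G : CK K -> 'rV[R]_m)
  (h : 'rV[R]_d -> CK K -> 'rV[R]_d) (th : 'rV[R]_d) (z : CK K) : 'rV[R]_d :=
  'D_(f th (G z)) (fun th' => h th' z) th.

End qsa.

Section qsa2.
Variable R : realType.
Definition Abar d (fbar : 'rV[R]_d -> 'rV[R]_d) (th v : 'rV[R]_d) : 'rV[R]_d :=
  'D_v fbar th.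
End qsa2.

(* Main.v *)
(* Along the clock, Poisson's equation and the fundamental theorem of calculus
   give d/dt gh(th, Phi_t) = gbar(th) - g(th, Phi_t) for fixed th, and since gh
   is C1 on Pi the chain rule adds the drift term:
     d/dt gh(Theta_t, Phi_t) = alpha [D^f gh] + gbar(Theta_t) - g(Theta_t, Phi_t).
   For gh = fh this turns Y' into alpha (fbar(Theta) - alpha Ups), and fbar(Theta)
   is rewritten by integrating the derivative of fbar on the segment from Theta
   to Y.  For gh = fhh it gives W2' = alpha [D^f fhh] - fh, because fh has mean
   zero, so alpha W1 + W2' = alpha Uh - fh; differentiating this identity with
   gh = Uh and gh = fh makes everything in W but f - fbar + alpha Upsbar
   cancel. *)
Require Import Defs.
From HB Require Import structures.
From mathcomp Require Import all_boot all_order all_algebra.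
From mathcomp Require Import all_classical all_reals all_analysis.
From mathcomp Require Import complex ring.
Import numFieldNormedType.Exports.
Import Order.TTheory GRing.Theory Num.Theory.
Local Open Scope classical_set_scope.
Local Open Scope ring_scope.

(** * Chain rule along curves, from directional derivatives *)

Lemma cvg_sumr (R : realType) (V : normedModType R) (T I : Type)
    (F : set_system T) (r : seq I) (f : I -> T -> V) (a : I -> V) :
  Filter F -> (forall i, f i x @[x --> F] --> a i) ->
  \sum_(i <- r) f i x @[x --> F] --> \sum_(i <- r) a i.
Proof.
move=> FF fa; apply: cvg_big => [|i _]; last exact: fa.
exact: add_continuous.
Qed.

Lemma continuous_pair_cst (U V : topologicalType) (v : V) :
  continuous (fun u : U => (u, v)).
Proof. by move=> u; apply: cvg_pair; [exact: cvg_id|exact: cvg_cst]. Qed.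

Lemma continuous_cst_pair (U V : topologicalType) (v : V) :
  continuous (fun u : U => (v, u)).
Proof. by move=> u; apply: cvg_pair; [exact: cvg_cst|exact: cvg_id]. Qed.

Lemma is_derive_line (R : realType) (V W : normedModType R) (F : V -> W)
    (x e : V) (r : R) :
  derivable F (x + r *: e) e ->
  is_derive r 1 (fun s : R => F (x + s *: e)) ('D_e F (x + r *: e)).
Proof.
have quotE : (fun h : R => h^-1 *: ((fun s : R => F (x + s *: e)) (h *: 1 + r)
                 - F (x + r *: e))) =
    (fun h => h^-1 *: (F (h *: e + (x + r *: e)) - F (x + r *: e))).
  apply/funext => h /=; congr (_ *: (F _ - _)).
  by rewrite scalerDl addrCA /GRing.scale /= mulr1.
by move=> dF; split; rewrite /derivable /derive /= quotE.
Qed.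

(** This is the mean value theorem for [s |-> F (x + s *: e)]. The bound [|r| <= |c|] serves both
    signs of [c] and sends the intermediate point to [x] as [c] tends to 0. *)
Lemma directional_MVT (R : realType) (V : normedModType R) (F : V -> R)
    (x e : V) (c : R) :
  (forall y, derivable F y e) ->
  exists2 r, `|r| <= `|c| & F (x + c *: e) - F x = c * 'D_e F (x + r *: e).
Proof.
move=> dF.
pose g (s : R) := F (x + s *: e).
have dg (s : R) : is_derive s 1 g ('D_e F (x + s *: e)) by exact: is_derive_line.
have gc a b : {within `[a, b], continuous g}.
  apply: derivable_within_continuous => s _.
  by apply: ex_derive; exact: dg.
have g0 : g 0 = F x by rewrite /g scale0r addr0.
rewrite -/(g c) -g0.
have [c0|c0] := leP 0 c.
- have [r + ->] := MVT_segment c0 (fun s _ => dg s) (gc _ _).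
  rewrite in_itv /= => /andP[r0 rc]; exists r; first by rewrite !ger0_norm.
  by rewrite subr0 mulrC.
- have [r + E] := MVT_segment (ltW c0) (fun s _ => dg s) (gc _ _).
  rewrite in_itv /= => /andP[rc r0]; exists r.
    by rewrite !ler0_norm ?lerN2 // ltW.
  by rewrite -opprB E sub0r mulrN opprK mulrC.
Qed.

(* The factor [eta] is a directional derivative at an intermediate point, so it
   carries both the continuity and the chain rule for [F] along curves, one
   direction at a time. *)
Lemma directional_increment (R : realType) (V : normedModType R)
    (T : topologicalType) (F : V -> T -> R) (y : T -> V) (c : T -> R) (e : V)
    (t : T) :
  (forall x s, derivable (F^~ s) x e) ->
  {for (y t, t), continuous (fun p : V * T => 'D_e (F^~ p.2) p.1)} ->
  {for t, continuous y} -> {for t, continuous c} -> c t = 0 ->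
  exists2 eta : T -> R, eta s @[s --> t] --> 'D_e (F^~ t) (y t) &
    forall s, F (y s + c s *: e) s = F (y s) s + c s * eta s.
Proof.
move=> dF cD cy cc ct.
(* Picking an intermediate point for each [s] defines [eta] without dividing by [c s], which may
   vanish. *)
have /choice[r rP] : forall s, exists r, `|r| <= `|c s| /\
    F (y s + c s *: e) s - F (y s) s = c s * 'D_e (F^~ s) (y s + r *: e).
  move=> s; have [r r1 r2] := @directional_MVT R V (F^~ s) (y s) e (c s) (dF^~ s).
  by exists r.
exists (fun s => 'D_e (F^~ s) (y s + r s *: e)); last first.
  by move=> s; rewrite -(rP s).2 [RHS]addrC subrK.
have cr : r s @[s --> t] --> 0.
  have c0 : c s @[s --> t] --> 0 by rewrite -ct.
  apply/cvgr0Pnorm_lt => eps eps0; near=> s.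
  apply: le_lt_trans (rP s).1 _.
  by near: s; exact: cvgr0_norm_lt.
have cz : y s + r s *: e @[s --> t] --> y t.
  rewrite -[in X in _ --> X](addr0 (y t)) -(scale0r e).
  by apply: cvgD => //; apply: cvgZr_tmp.
exact: (cvg_comp _ _ (cvg_pair cz cvg_id) cD).
Unshelve. all: by end_near. Qed.

(** Since [c t = 0], the difference quotient of the product is that of [c] times a value of [eta],
    so a limit of [eta] suffices and no derivative of it is involved. *)
Lemma is_derive_mul_vanishing (R : realType) (c eta : R -> R) (t c' l : R) :
  c t = 0 -> is_derive t 1 c c' -> eta s @[s --> t] --> l ->
  is_derive t 1 (fun s => c s * eta s) (c' * l).
Proof.
move=> ct dc etal.
have cshift : h *: (1 : R) + t @[h --> (0 : R)^'] --> t.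
  have c0 : {for (0 : R), continuous (fun h : R => h *: (1 : R) + t)}.
    apply: cvgD; last exact: cvg_cst.
    exact: scalel_continuous.
  move: c0; rewrite /prop_for /continuous_at scale0r add0r => c0.
  by apply: cvg_trans c0; exact: cvg_fmap2 (cvg_within _).
have L : h^-1 *: ((fun s => c s * eta s) (h *: 1 + t) - c t * eta t)
    @[h --> (0 : R)^'] --> c' * l.
  have -> : (fun h : R => h^-1 *: ((fun s => c s * eta s) (h *: 1 + t) - c t * eta t))
    = (fun h => h^-1 *: (c (h *: 1 + t) - c t) * eta (h *: 1 + t)).
    by apply/funext => h /=; rewrite ct mul0r !subr0 /GRing.scale /= mulrA.
  apply: cvgM; last exact: (cvg_comp _ _ cshift etal).
  by rewrite -(@derive_val _ _ _ _ _ _ _ dc); exact: ex_derive.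
by apply: DeriveDef; [apply/cvg_ex; exists (c' * l)|exact/cvg_lim].
Qed.

(** Induction on the directions: each one adds [c i s * eta s], a vanishing factor times a
    convergent one. *)
Lemma curve_continuous (R : realType) (V : normedModType R)
    (T : topologicalType) (I : Type) (F : V -> R) (x : V) (r : seq I)
    (c : I -> T -> R) (e : I -> V) (t : T) :
  (forall i y, derivable F y (e i)) ->
  (forall i, {for x, continuous (fun y => 'D_(e i) F y)}) ->
  (forall i, {for t, continuous (c i)}) -> (forall i, c i t = 0) ->
  F (x + \sum_(i <- r) c i s *: e i) @[s --> t] --> F x.
Proof.
move=> dF cD cc c0.
elim: r => [|i r IH].
  by under eq_fun do rewrite big_nil addr0; exact: cvg_cst.
pose y s := x + \sum_(i <- r) c i s *: e i.
have yt : y t = x by rewrite /y big1 ?addr0 // => j _; rewrite c0 scale0r.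
have cy : {for t, continuous y}.
  apply: cvgD; first exact: cvg_cst.
  by apply: cvg_sumr => j; apply: cvgZr_tmp; exact: cc.
have cDy : {for (y t, t), continuous (fun p : V * T => 'D_(e i) F p.1)}.
  rewrite yt; apply: (@continuous_comp _ _ _ fst (fun z => 'D_(e i) F z)).
    exact: cvg_fst.
  exact: cD.
have [eta etat Feta] := @directional_increment _ _ _ (fun z _ => F z) y _ _ t
  (fun z _ => dF i z) cDy cy (cc i) (c0 i).
under eq_fun do rewrite big_cons [c i _ *: _ + _]addrC addrA Feta.
rewrite -[F x]addr0 -(mul0r ('D_(e i) F (y t))) -(c0 i).
by apply: cvgD; [exact: IH|apply: cvgM => //; exact: cc].
Qed.

Lemma curve_derive (R : realType) (V : normedModType R) (I : Type)
    (F : V -> R -> R) (x : V) (r : seq I) (c : I -> R -> R) (c' : I -> R)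
    (e : I -> V) (t w : R) :
  (forall i y s, derivable (F^~ s) y (e i)) ->
  (forall i, {for (x, t), continuous (fun p : V * R => 'D_(e i) (F^~ p.2) p.1)}) ->
  (forall i, is_derive t 1 (c i) (c' i)) -> (forall i, c i t = 0) ->
  is_derive t 1 (F x) w ->
  is_derive t 1 (fun s => F (x + \sum_(i <- r) c i s *: e i) s)
    (w + \sum_(i <- r) c' i * 'D_(e i) (F^~ t) x).
Proof.
move=> dF cD dc c0 dw.
have cc i : {for t, continuous (c i)}.
  by apply/differentiable_continuous/derivable1_diffP/ex_derive.
elim: r => [|i r IH].
  by rewrite big_nil addr0; under eq_fun do rewrite big_nil addr0.
pose y s := x + \sum_(i <- r) c i s *: e i.
have yt : y t = x by rewrite /y big1 ?addr0 // => j _; rewrite c0 scale0r.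
have cy : {for t, continuous y}.
  apply: cvgD; first exact: cvg_cst.
  by apply: cvg_sumr => j; apply: cvgZr_tmp; exact: cc.
have cDy : {for (y t, t), continuous (fun p : V * R => 'D_(e i) (F^~ p.2) p.1)}.
  by rewrite yt.
have [eta etat Feta] :=
  @directional_increment _ _ _ F y _ _ t (dF i) cDy cy (cc i) (c0 i).
under eq_fun do rewrite big_cons [c i _ *: _ + _]addrC addrA Feta.
rewrite big_cons [_ * _ + _]addrC addrA.
apply: is_deriveD.
by rewrite -yt; apply: is_derive_mul_vanishing.
Qed.

(** * Row vectors, coordinate by coordinate *)

Lemma row_sum_scale (R : realType) (d : nat) (x : 'rV[R]_d) :
  x = \sum_(i < d) x 0 i *: delta_mx 0 i.
Proof. by rewrite [LHS]matrix_sum_delta big_ord1. Qed.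

Lemma is_derive_rowP (R : realType) (V : normedModType R) (n : nat)
    (g : V -> 'rV[R]_n) (x v : V) (l : 'rV[R]_n) :
  is_derive x v g l <-> forall j, is_derive x v (fun y => g y 0 j) (l 0 j).
Proof.
split=> [[dg <-] j|dg].
  split; first exact: (derivable_mxP _ _ _).1.
  by rewrite derive_mx // mxE.
have dg' : derivable g x v.
  by apply/derivable_mxP => i j; rewrite ord1; exact: ex_derive.
split => //; rewrite derive_mx //; apply/rowP => j; rewrite mxE.
exact: derive_val.
Qed.

Lemma cvg_rowP (R : realType) (T : Type) (F : set_system T) (n : nat)
    (g : T -> 'rV[R]_n) (l : 'rV[R]_n) : Filter F ->
  (forall j, g x 0 j @[x --> F] --> l 0 j) -> g x @[x --> F] --> l.
Proof.
move=> FF gl; apply/cvgrPdist_le => /= e e0.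
near=> x.
rewrite /Num.Def.normr/= mx_normrE (bigmax_le _ (ltW e0))//= => -[i j] _.
rewrite !mxE (ord1 i) {i}; move: j; near: x; apply: filter_forall => /= j.
exact: ((cvgrPdist_le _ _).1 (gl j)).
Unshelve. all: by end_near. Qed.

Lemma continuous_row_coord (R : realType) (T : topologicalType) (n : nat)
    (g : T -> 'rV[R]_n) (j : 'I_n) :
  continuous g -> continuous (fun x => g x 0 j).
Proof.
move=> cg x.
apply: (@continuous_comp _ _ _ g (fun M : 'rV[R]_n => M 0 j) x (cg x)).
exact: coord_continuous.
Qed.

(** * The clock and Poisson's equation along it *)

Section clock.
Context {R : realType} {K : nat} (om ph : 'I_K -> R).

(** Poisson's equation is stated along [flow] and the dynamics along [clock]; the angle addition
    formulas link the two. *)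
Lemma clock_flow (t : R) : clock om ph t = flow om t (clock om ph 0).
Proof.
apply: eq_from_tnth => i; rewrite !tnth_mktuple /cmul /expj /=.
rewrite mulr0 add0r !mulrDr addrC cosD sinD.
by congr (_, _); rewrite addrC.
Qed.

Lemma Omega_clock (t : R) : Omega om ph (clock om ph t).
Proof. by move=> e e0; exists t => i; rewrite !subrr !normr0. Qed.

Lemma clock_coord_continuous (i : 'I_K) :
  continuous (fun t => (tnth (clock om ph t) i).1) /\
  continuous (fun t => (tnth (clock om ph t) i).2).
Proof.
have cl : continuous (fun t => 2 * pi * (om i * t + ph i)).
  move=> t; apply: cvgM; first exact: cvg_cst.
  apply: cvgD; last exact: cvg_cst.
  by apply: cvgM; [exact: cvg_cst|exact: cvg_id].
split=> t; under eq_fun do rewrite tnth_mktuple /expj /=.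
- by apply: (continuous_comp (cl t)); exact: continuous_cos.
- by apply: (continuous_comp (cl t)); exact: continuous_sin.
Qed.

Lemma clock_continuous (t e : R) : 0 < e ->
  \forall s \near t, distCK (clock om ph s) (clock om ph t) < e.
Proof.
move=> e0; near=> s.
apply/bigmax_ltP; split => // i _; rewrite gt_max; apply/andP; split.
- move: i; near: s; apply: filter_forall => i.
  exact: ((cvgrPdistC_lt _ _).1 ((clock_coord_continuous i).1 t)).
- move: i; near: s; apply: filter_forall => i.
  exact: ((cvgrPdistC_lt _ _).1 ((clock_coord_continuous i).2 t)).
Unshelve. all: by end_near. Qed.

(** The clock never leaves [Omega], so continuity tested only at points of [Omega] becomes ordinary
    joint continuity in the parameter and time. *)
Lemma cont_Pi_clock (d n : nat) (H : 'rV[R]_d -> CK R K -> 'rV[R]_n) :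
  cont_Pi (Omega om ph) H ->
  continuous (fun p : 'rV[R]_d * R => H p.1 (clock om ph p.2)).
Proof.
move=> cH [x t]; apply/cvgrPdist_lt => /= e e0.
have [del del0 Hdel] := cH x _ (Omega_clock t) e e0.
have Nx : \forall y \near x, `|y - x| < del.
  by apply/nbhs_normP; exists del => //= y; rewrite /ball_ /= distrC.
have Nt := clock_continuous t _ del0.
near=> p; rewrite distrC; apply: Hdel; first exact: Omega_clock.
- by near: p; exact: (@cvg_fst _ _ _ _ _ _ Nx).
- by near: p; exact: (@cvg_snd _ _ _ _ _ _ Nt).
Unshelve. all: by end_near. Qed.

(** Poisson's equation between times 0 and [s] writes [gh] as a constant minus an integral up to
    [s], which the fundamental theorem of calculus differentiates. *)
Lemma poisson_sol_derive (d : nat) (P : probability (CK R K) R)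
    (g gh : 'rV[R]_d -> CK R K -> 'rV[R]_d) (th : 'rV[R]_d) (t : R) :
  poisson_sol om ph P g gh ->
  continuous (fun s => g th (clock om ph s)) -> 0 < t ->
  is_derive t 1 (fun s => gh th (clock om ph s))
    (avg P (Omega om ph) (g th) - g th (clock om ph t)).
Proof.
move=> [sol _] cg t0; apply/is_derive_rowP => j.
pose gj s := (g th (flow om s (clock om ph 0)) - avg P (Omega om ph) (g th)) 0 j.
have cgj : continuous gj.
  move=> s; rewrite /gj; under eq_fun do rewrite !mxE -clock_flow.
  apply: cvgB; last exact: cvg_cst.
  exact: continuous_row_coord cg _.
(* The right end [t + 1] makes [t] an interior point of the interval. *)
have igj : (@lebesgue_measure R).-integrable `[0, t + 1] (EFin \o gj).
  apply: continuous_compact_integrable; first exact: segment_compact.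
  exact: continuous_subspaceT.
have tt1 : t < t + 1 by rewrite ltrDl.
have [dI I'] := @continuous_FTC1_closed R gj 0 t (t + 1) tt1 igj t0 (cgj t).
pose I s := Rintegral (@lebesgue_measure R) `[0, s] gj.
(* The identity is available only for [s >= 0], hence near [t] because [t] is positive. *)
have eqgh : \forall s \near t, gh th (clock om ph 0) 0 j - I s = gh th (clock om ph s) 0 j.
  near=> s.
  have s0 : 0 <= s by near: s; exact: lt_le_nbhsr.
  rewrite (clock_flow s).
  have := sol th _ (Omega_clock 0) 0 s (lexx _) s0.
  rewrite -(clock_flow 0) => ->; rewrite !mxE.
  by rewrite addrAC subrr add0r.
apply: (near_eq_is_derive eqgh).
have -> : (avg P (Omega om ph) (g th) - g th (clock om ph t)) 0 j = 0 - gj t.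
  by rewrite /gj !mxE -clock_flow sub0r opprB.
apply: is_deriveB; rewrite -I' derive1E.
exact: (DeriveDef dI).
Unshelve. all: by end_near. Qed.

End clock.

(** * Continuity of [C1] maps *)

Lemma derivable_coord (R : realType) (V : normedModType R) (n : nat)
    (g : V -> 'rV[R]_n) (x v : V) (j : 'I_n) :
  derivable g x v -> derivable (fun y => g y 0 j) x v.
Proof. by move=> dg; exact: (derivable_mxP _ _ _).1. Qed.

Lemma derive_coord (R : realType) (V : normedModType R) (n : nat)
    (g : V -> 'rV[R]_n) (x v : V) (j : 'I_n) :
  derivable g x v -> 'D_v (fun y => g y 0 j) x = ('D_v g x) 0 j.
Proof. by move=> dg; rewrite derive_mx // mxE. Qed.

(** The moving point [y] itself is the parameter of the curve in [curve_continuous], with the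
    coordinates of [y - x] as coefficients. *)
Lemma continuous_coordwise (R : realType) (n : nat) (F : 'rV[R]_n -> R) :
  (forall i x, derivable F x (delta_mx 0 i)) ->
  (forall i, continuous (fun x => 'D_(delta_mx 0 i) F x)) ->
  continuous F.
Proof.
move=> dF cD x.
have E y : F y = F (x + \sum_(i < n) (y - x) 0 i *: delta_mx 0 i).
  by rewrite -row_sum_scale addrC subrK.
suff H : (fun y => F (x + \sum_(i < n) (y - x) 0 i *: delta_mx 0 i)) @ x --> F x.
  by rewrite -(funext E) in H.
apply: curve_continuous => // i.
- exact: cD.
- apply: continuous_row_coord.
  by move=> y; exact: (cvgB (@cvg_id _ (nbhs y)) (cvg_cst _)).
- by rewrite subrr mxE.
Qed.

Lemma C1_continuous (R : realType) (n k : nat) (F : 'rV[R]_n -> 'rV[R]_k) :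
  C1 F -> continuous F.
Proof.
move=> [dF cD] x; apply: (@cvg_rowP _ _ (nbhs x)) => j.
apply: continuous_coordwise => [i y|i].
- exact: derivable_coord.
- under eq_fun do rewrite derive_coord //.
  exact: continuous_row_coord.
Qed.

Lemma C1_section (R : realType) (U V W : normedModType R) (f : U -> V -> W)
    (u : U) :
  C1 (fun p : U * V => f p.1 p.2) -> C1 (f u).
Proof.
move=> [df cD].
have quotE (x v : V) :
    (fun h : R => h^-1 *: ((fun p : U * V => f p.1 p.2) (h *: (0, v) + (u, x)) - f u x)) =
    (fun h : R => h^-1 *: (f u (h *: v + x) - f u x)).
  by apply/funext => h /=; rewrite scaler0 add0r.
split=> [x v|v].
- by rewrite /derivable -quotE; exact: df.
- have -> : (fun x => 'D_v (f u) x) =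
      (fun x => 'D_(0, v) (fun p : U * V => f p.1 p.2) (u, x)).
    by apply/funext => x; rewrite /derive -quotE.
  move=> x; apply: (@continuous_comp _ _ _ (fun x : V => (u, x))
    (fun p => 'D_(0, v) (fun p : U * V => f p.1 p.2) p)); last exact: cD.
  exact: continuous_cst_pair.
Qed.

(** * Absolutely summable power series and continuity of the probing signal *)

Section power_series.
Context {R : realType} {K m : nat} (c : ('I_K -> nat) -> 'rV[R]_m).

(** [A] is the set of multi-indices of the large box outside the embedded small one. It is chosen
    before [V] and [h], so that one [A] serves both the terms of the series and the norms of its
    coefficients. *)
Lemma box_sum_diff (N N' : nat) :
  (N <= N')%N -> exists A : {set {ffun 'I_K -> 'I_N'.+1}},
    forall (V : zmodType) (h : ('I_K -> nat) -> V),
    \sum_(b : {ffun 'I_K -> 'I_N'.+1}) h (fun i => nat_of_ord (b i)) -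
    \sum_(a : {ffun 'I_K -> 'I_N.+1}) h (fun i => nat_of_ord (a i)) =
    \sum_(b in A) h (fun i => nat_of_ord (b i)).
Proof.
move=> NN'.
pose w (a : {ffun 'I_K -> 'I_N.+1}) : {ffun 'I_K -> 'I_N'.+1} :=
  [ffun i => widen_ord (NN' : (N < N'.+1)%N) (a i)].
have winj : injective w.
  move=> a b /ffunP ab; apply/ffunP => i; apply/val_inj.
  by have := ab i; rewrite !ffunE => /(congr1 val).
pose B := (w @: [set: {ffun 'I_K -> 'I_N.+1}])%SET.
exists (~: B)%SET => V h.
rewrite (bigID (mem B)) /= {1}/B big_imset /=; last by move=> ? ? _ _; exact: winj.
have -> : \sum_(a in [set: {ffun 'I_K -> 'I_N.+1}]%SET) h (fun i => nat_of_ord (w a i))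
    = \sum_(a : {ffun 'I_K -> 'I_N.+1}) h (fun i => nat_of_ord (a i)).
  apply: eq_big => [a|a _]; first by rewrite inE.
  by congr h; apply/funext => i; rewrite ffunE.
by rewrite addrAC subrr add0r; apply: eq_bigl => b; rewrite !inE.
Qed.

Let in_box (x : 'rV[R]_K) := forall i, `|x 0 i| <= 1.

(** Every monomial has absolute value at most 1 on the unit box, so the bound does not depend on
    [x]. *)
Lemma box_sum_tail (N N' : nat) (x : 'rV[R]_K) : (N <= N')%N -> in_box x ->
  `|box_sum c x N' - box_sum c x N| <=
  \sum_(b : {ffun 'I_K -> 'I_N'.+1}) `|c (fun i => nat_of_ord (b i))| -
  \sum_(a : {ffun 'I_K -> 'I_N.+1}) `|c (fun i => nat_of_ord (a i))|.
Proof.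
move=> NN' xb; have [A AE] := box_sum_diff _ _ NN'.
rewrite (AE _ (fun k => `|c k|)) /box_sum.
rewrite (AE _ (fun k => (\prod_i x 0 i ^+ k i) *: c k)).
apply: le_trans (ler_norm_sum _ _ _) _; apply: ler_sum => b _.
rewrite normrZ ler_piMl // normr_prod.
apply: prodr_ile1 => i _; rewrite normr_ge0 normrX.
by rewrite exprn_ile1.
Qed.

Lemma box_sum_continuous (N : nat) : continuous (fun x => box_sum c x N).
Proof.
move=> x; apply: (@cvg_sumr _ _ _ _ (nbhs x)) => b; apply: cvgZr_tmp.
apply: cvg_big => [|i _].
  exact: mul_continuous.
apply: (@continuous_comp _ _ _ (fun x : 'rV[R]_K => x 0 i) (fun y => y ^+ b i)).
  exact: coord_continuous.
exact: exprn_continuous.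
Qed.

(** Weierstrass M-test: [N] is read off the bounded nondecreasing sums of coefficient norms, hence
    is the same for all [x]. *)
Lemma box_sum_unif (G0 : 'rV[R]_K -> 'rV[R]_m) (e : R) :
  abs_summable_coef c ->
  (forall x, in_box x -> box_sum c x @ \oo --> G0 x) -> 0 < e ->
  exists N, forall x, in_box x -> `|G0 x - box_sum c x N| < e.
Proof.
move=> [M SM] cG e0.
pose S N := \sum_(a : {ffun 'I_K -> 'I_N.+1}) `|c (fun i => nat_of_ord (a i))|.
have ndS : nondecreasing_seq S.
  move=> N N' NN'; rewrite -subr_ge0 /S.
  have [A AE] := box_sum_diff _ _ NN'.
  by rewrite (AE _ (fun k => `|c k|)); apply: sumr_ge0.
have cS : cvgn S.
  apply: nondecreasing_is_cvgn => //; exists M => _ [N _ <-]; exact: SM.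
have e20 : 0 < e / 2 by rewrite divr_gt0.
have [N _ HN] := (cvgrPdist_lt _ _).1 cS (e / 2) e20.
exists N => x xb.
have [N' _ HN'] := (cvgrPdist_lt _ _).1 (cG x xb) (e / 2) e20.
(* [N'] depends on [x], but the sum up to [n] is only an intermediate point of comparison and leaves
   [N] unchanged. *)
pose n := maxn N N'.
rewrite -(subrKA (box_sum c x n)) [e]splitr.
apply: le_lt_trans (ler_normD _ _) _; apply: ltr_leD.
  by apply: HN'; exact: leq_maxr.
apply: le_trans (box_sum_tail _ _ _ (leq_maxl _ _) xb) _.
apply: le_trans (ltW (HN N (leqnn _))).
apply: le_trans (ler_norm _); rewrite lerB //.
exact: nondecreasing_cvgn_le.
Qed.

(** A uniform limit of polynomials, by splitting [e] into thirds. The series represents [G0] on the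
    closed box only, so continuity is stated along maps with values there. *)
Lemma power_series_continuous_comp (G0 : 'rV[R]_K -> 'rV[R]_m)
    (T : topologicalType) (x : T -> 'rV[R]_K) :
  abs_summable_coef c ->
  (forall y, in_box y -> box_sum c y @ \oo --> G0 y) ->
  continuous x -> (forall s, in_box (x s)) -> continuous (G0 \o x).
Proof.
move=> sc cG cx xb t; apply/cvgrPdist_lt => /= e e0.
have e30 : 0 < e / 3 by rewrite divr_gt0.
have [N HN] := box_sum_unif _ _ sc cG e30.
near=> s.
have -> : e = e / 3 + (e / 3 + e / 3) by field.
rewrite -(subrKA (box_sum c (x t) N)).
apply: le_lt_trans (ler_normD _ _) _; apply: ltrD; first exact: HN.
rewrite -(subrKA (box_sum c (x s) N)).
apply: le_lt_trans (ler_normD _ _) _; apply: ltrD; last first.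
  by rewrite distrC; exact: HN.
near: s; apply: ((cvgrPdist_lt _ _).1 _ _ e30).
exact: (@continuous_comp _ _ _ x (fun y => box_sum c y N) t (cx t) (box_sum_continuous N (x t))).
Unshelve. all: by end_near. Qed.

End power_series.

(* On the unit circle [1/z] is the conjugate of [z]. *)
Lemma Gsig_clock (R : realType) (K m : nat) (om ph : 'I_K -> R)
    (G0 : 'rV[R]_K -> 'rV[R]_m) (t : R) :
  Gsig G0 (clock om ph t) = G0 (\row_i (tnth (clock om ph t) i).1).
Proof.
rewrite /Gsig; congr G0; apply/rowP => i; rewrite !mxE tnth_mktuple /expj /toC /=.
set a := cos _; set b := sin _.
have ab : a ^+ 2 + b ^+ 2 = 1 by exact: cos2Dsin2.
by rewrite ab; field.
Qed.

Lemma Gsig_clock_continuous (R : realType) (K m : nat) (om ph : 'I_K -> R)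
    (G0 : 'rV[R]_K -> 'rV[R]_m) :
  power_series_abs_summable G0 -> continuous (fun t => Gsig G0 (clock om ph t)).
Proof.
move=> [c [sc cG]]; under eq_fun do rewrite Gsig_clock.
apply: (power_series_continuous_comp c G0 _ (fun t => \row_i (tnth (clock om ph t) i).1)) => //.
- move=> t; apply: (@cvg_rowP _ _ (nbhs t)) => j; rewrite mxE.
  under eq_fun do rewrite mxE.
  exact: (clock_coord_continuous _ _ _).1.
- move=> s i; rewrite mxE tnth_mktuple /=.
  by rewrite ler_norml cos_geN1 cos_le1.
Qed.

(** * Linearity of the derivative in its direction, and integration along a segment *)

(** The function [s |-> f (x + s *: v)] is differentiated at 0 in two ways, as a line in direction
    [v] and one coordinate at a time by [curve_derive]; uniqueness of the derivative concludes. *)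
Lemma derive_row_sum (R : realType) (d n : nat) (F : 'rV[R]_d -> 'rV[R]_n)
    (x v : 'rV[R]_d) :
  (forall y u, derivable F y u) ->
  (forall u, continuous (fun y => 'D_u F y)) ->
  'D_v F x = \sum_(i < d) v 0 i *: 'D_(delta_mx 0 i) F x.
Proof.
move=> dF cD; apply/rowP => j; rewrite -derive_coord // summxE.
under eq_bigr do rewrite mxE -derive_coord //.
set f := fun y => F y 0 j.
have df y u : derivable f y u by exact: derivable_coord.
have cDf i : continuous (fun y => 'D_(delta_mx 0 i) f y).
  under eq_fun do rewrite derive_coord //.
  exact: continuous_row_coord.
have L : is_derive (0 : R) 1 (fun s : R => f (x + s *: v)) ('D_v f x).
  have := is_derive_line _ _ _ f x v 0 (df _ _).
  by rewrite scale0r addr0.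
have dc (i : 'I_d) : is_derive (0 : R) 1 (fun s : R => s * v 0 i) (v 0 i).
  rewrite (_ : (fun s => s * v 0 i) = v 0 i \*: (@id R)).
    by rewrite -[X in is_derive _ _ _ X]mulr1; apply: is_deriveZ.
  by apply/funext => s; rewrite mulrC.
have U : is_derive (0 : R) 1 (fun s : R => f (x + s *: v))
    (0 + \sum_(i < d) v 0 i * 'D_(delta_mx 0 i) f x).
  have -> : (fun s : R => f (x + s *: v)) =
      (fun s => f (x + \sum_(i < d) (s * v 0 i) *: delta_mx 0 i)).
    apply/funext => s; rewrite {1}(row_sum_scale _ _ v) scaler_sumr.
    by under eq_bigr do rewrite scalerA.
  apply: (@curve_derive _ _ _ (fun y _ => f y) x _ (fun i s => s * v 0 i)
    (fun i => v 0 i)) => //.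
  - move=> i.
    apply: (@continuous_comp _ _ _ fst (fun y => 'D_(delta_mx 0 i) f y)).
      exact: cvg_fst.
    exact: cDf.
  - by move=> i; rewrite mul0r.
by rewrite -(@derive_val _ _ _ _ _ _ _ L) (@derive_val _ _ _ _ _ _ _ U) add0r.
Qed.

Lemma C1_deriveZ (R : realType) (d n : nat) (F : 'rV[R]_d -> 'rV[R]_n)
    (x v : 'rV[R]_d) (a : R) :
  C1 F -> 'D_(a *: v) F x = a *: 'D_v F x.
Proof.
move=> [dF cD]; rewrite !(derive_row_sum _ _ _ F x) // scaler_sumr.
by apply: eq_bigr => i _; rewrite mxE scalerA.
Qed.

(** The fundamental theorem of calculus along the segment. The factor [a] stays outside the
    integral, so that the integrand with [a = alpha] is that of [B_t] applied to [v]. *)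
Lemma C1_segment (R : realType) (d n : nat) (F : 'rV[R]_d -> 'rV[R]_n)
    (y v : 'rV[R]_d) (a : R) :
  C1 F ->
  F y - F (y - a *: v) = a *: vint 0 1 (fun r => 'D_v F (y - (r * a) *: v)).
Proof.
move=> CF; have [dF cD] := CF; apply/rowP => j; rewrite !mxE.
pose u := (- a) *: v.
have lineE r : y - (r * a) *: v = y + r *: u.
  by rewrite /u scalerA mulrN scaleNr.
pose g (r : R) := F (y + r *: u) 0 j.
pose dg (r : R) := ('D_v F (y + r *: u)) 0 j.
have cdg : continuous dg.
  apply: continuous_row_coord => r.
  apply: (@continuous_comp _ _ _ (fun r : R => y + r *: u) (fun x => 'D_v F x)); last exact: cD.
  by apply: cvgD; [exact: cvg_cst|exact: scalel_continuous].
have dgE (r : R) : is_derive r 1 g ((- a) * dg r).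
  have H := is_derive_line _ _ _ F y u r (dF _ _).
  have /is_derive_rowP/(_ j) := H.
  by rewrite C1_deriveZ // mxE.
have idg : (@lebesgue_measure R).-integrable `[0, 1] (EFin \o dg).
  apply: continuous_compact_integrable; first exact: segment_compact.
  exact: continuous_subspaceT.
have cg : continuous g.
  move=> r; apply/differentiable_continuous/derivable1_diffP.
  exact: ex_derive.
have ftc : Rintegral (@lebesgue_measure R) `[0, 1] (fun r => (- a) * dg r) = g 1 - g 0.
  rewrite /Rintegral (@continuous_FTC2 R _ g) //.
  - apply: continuous_subspaceT => r.
    by apply: cvgM; [exact: cvg_cst|exact: cdg].
  - split.
    + by move=> r _; exact: ex_derive.
    + exact: cvg_at_right_filter (cg _).
    + exact: cvg_at_left_filter (cg _).
  - by move=> r _; rewrite derive1E; exact: derive_val.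
move: ftc; rewrite RintegralZl // mulNr => /eqP; rewrite eqr_oppLR opprB => /eqP ftc.
under eq_Rintegral do rewrite lineE.
by rewrite -/dg ftc /g scale0r addr0 scale1r /u scaleNr.
Qed.

(** * Differentiation along the solution and the clock together *)

Section chain.
Context {R : realType} {K d : nat} (om ph : 'I_K -> R).
Let Om := Omega om ph.
Let Phi := clock om ph.

Lemma C1_Pi_C1 (h : 'rV[R]_d -> CK R K -> 'rV[R]_d) (t : R) :
  C1_Pi Om h -> C1 (fun th => h th (Phi t)).
Proof.
move=> [_ [dh cDh]]; split=> [x v|v x]; first exact/dh/Omega_clock.
have H := cont_Pi_clock _ _ _ _ _ (cDh v) (x, t).
apply: (@continuous_comp _ _ _ (fun x : 'rV[R]_d => (x, t))
  (fun p => 'D_v (fun th => h th (Phi p.2)) p.1) x _ H).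
exact: continuous_pair_cst.
Qed.

(** Expanding [Theta s - Theta t] in the basis gives coefficients that vanish at [t], as
    [curve_derive] requires. The clock enters only through [w], at frozen parameter, so [h] is never
    differentiated in its second argument. *)
Lemma C1_Pi_chain (h : 'rV[R]_d -> CK R K -> 'rV[R]_d) (Theta : R -> 'rV[R]_d)
    (t : R) (v w : 'rV[R]_d) :
  C1_Pi Om h -> is_derive t 1 Theta v ->
  is_derive t 1 (fun s => h (Theta t) (Phi s)) w ->
  is_derive t 1 (fun s => h (Theta s) (Phi s))
    ('D_v (fun th => h th (Phi t)) (Theta t) + w).
Proof.
move=> Ch dTheta dh; have [_ [dDh cDh]] := Ch.
have [dht cht] := C1_Pi_C1 h t Ch.
apply/is_derive_rowP => j; rewrite mxE (derive_row_sum _ _ _ _ _ v) // summxE addrC.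
under eq_bigr do rewrite mxE -derive_coord //.
have -> : (fun s => h (Theta s) (Phi s) 0 j) =
   (fun s => h (Theta t + \sum_(i < d) (Theta s - Theta t) 0 i *: delta_mx 0 i) (Phi s) 0 j).
  by apply/funext => s; rewrite -row_sum_scale addrC subrK.
apply: (@curve_derive _ _ _ (fun th s => h th (Phi s) 0 j) (Theta t) _
   (fun i s => (Theta s - Theta t) 0 i) (fun i => v 0 i)).
- by move=> i y s; apply: derivable_coord; exact/dDh/Omega_clock.
- move=> i.
  have -> : (fun p : 'rV[R]_d * R => 'D_(delta_mx 0 i) (fun th => h th (Phi p.2) 0 j) p.1)
     = (fun p => ('D_(delta_mx 0 i) (fun th => h th (Phi p.2)) p.1) 0 j).
    by apply/funext => p; rewrite derive_coord //; exact/dDh/Omega_clock.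
  apply: continuous_row_coord; exact: cont_Pi_clock (cDh _).
- move=> i; rewrite -[v 0 i]subr0.
  have : is_derive t 1 (fun s => Theta s - Theta t) (v - 0).
    by apply: is_deriveB.
  by move/is_derive_rowP/(_ i); rewrite !mxE.
- by move=> i; rewrite subrr mxE.
- exact: (is_derive_rowP _ _ _ _ _ _ _).1.
Qed.

End chain.

Section qsa_flow.
Context {R : realType} {K d : nat} (om ph : 'I_K -> R).
Let Om := Omega om ph.
Let Phi := clock om ph.

(** This gives the continuity in time of the forcing [Ups]. The direction moves with [s], so it is
    expanded in the fixed basis, where the continuity in [C1_Pi] applies. *)
Lemma C1_Pi_derive_continuous (h : 'rV[R]_d -> CK R K -> 'rV[R]_d)
    (th : 'rV[R]_d) (u : R -> 'rV[R]_d) :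
  C1_Pi Om h -> continuous u ->
  continuous (fun s => 'D_(u s) (fun th' => h th' (Phi s)) th).
Proof.
move=> Ch cu.
have E s : 'D_(u s) (fun th' => h th' (Phi s)) th =
    \sum_(i < d) u s 0 i *: 'D_(delta_mx 0 i) (fun th' => h th' (Phi s)) th.
  have [dF cF] := C1_Pi_C1 om ph h s Ch.
  exact: (derive_row_sum _ _ _ _ th (u s) dF cF).
under eq_fun do rewrite E.
move=> s; apply: cvg_sumr => i; apply: cvgZ; first exact: continuous_row_coord.
have [_ [_ cDh]] := Ch.
apply: (@continuous_comp _ _ _ (fun s : R => (th, s))
  (fun p => 'D_(delta_mx 0 i) (fun th' => h th' (Phi p.2)) p.1) s).
  exact: continuous_cst_pair.
exact: cont_Pi_clock (cDh _) _.
Qed.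

Lemma poisson_sol_chain (P : probability (CK R K) R)
    (g gh : 'rV[R]_d -> CK R K -> 'rV[R]_d) (Theta : R -> 'rV[R]_d) (t : R)
    (v : 'rV[R]_d) :
  poisson_sol om ph P g gh -> C1_Pi Om gh ->
  (forall th, continuous (fun s => g th (Phi s))) ->
  0 < t -> is_derive t 1 Theta v ->
  is_derive t 1 (fun s => gh (Theta s) (Phi s))
    ('D_v (fun th => gh th (Phi t)) (Theta t) +
     (avg P Om (g (Theta t)) - g (Theta t) (Phi t))).
Proof.
move=> sol Cgh cg t0 dTheta.
apply: C1_Pi_chain => //.
exact: poisson_sol_derive.
Qed.

End qsa_flow.

(** * The two forms of the averaged dynamics *)

Theorem theorem2p3 (R : realType) (d m K : nat) (om ph : 'I_K -> R)
  (G0 : 'rV[R]_K -> 'rV[R]_m) (f : 'rV[R]_d -> 'rV[R]_m -> 'rV[R]_d)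
  (alpha : R) (P : probability (CK R K) R)
  (fh fhh Uh : 'rV[R]_d -> CK R K -> 'rV[R]_d) (Theta : R -> 'rV[R]_d) :
  (0 < d)%N -> (0 < m)%N -> (0 < K)%N -> (forall i, 0 < om i) ->
  power_series_abs_summable G0 ->
  C1 (fun p : 'rV[R]_d * 'rV[R]_m => f p.1 p.2) ->
  is_haar_on om ph P ->
  0 < alpha ->
  let Om := Omega om ph in
  let G := Gsig G0 in
  let fbar := fun th => avg P Om (fun z => f th (G z)) in
  C1 fbar ->
  let Ups := fun th z => - Df f G fh th z in
  poisson_sol om ph P (fun th z => f th (G z)) fh ->
  poisson_sol om ph P fh fhh ->
  poisson_sol om ph P Ups Uh ->
  C1_Pi Om fh -> C1_Pi Om fhh -> C1_Pi Om Uh ->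
  let Phi := clock om ph in
  (forall t : R, 0 < t -> is_derive t 1 Theta (alpha *: f (Theta t) (G (Phi t)))) ->
  let fh_t := fun t : R => fh (Theta t) (Phi t) in
  let Y := fun t : R => Theta t + alpha *: fh_t t in
  (* (i) *)
  (forall t : R, 0 < t ->
     is_derive t 1 Y
       (alpha *: (fbar (Y t)
          - alpha *: (vint 0 1 (fun r => Abar fbar (Y t - (r * alpha) *: fh_t t) (fh_t t))
                      + Ups (Theta t) (Phi t)))))
  /\
  (* (ii) *)
  (let W0 := fun t : R => - Df f G Uh (Theta t) (Phi t) in
   let W1 := fun t : R => - Df f G fhh (Theta t) (Phi t) + Uh (Theta t) (Phi t) in
   let W2 := fun t : R => fhh (Theta t) (Phi t) in
   (forall t : R, 0 < t -> derivable W1 t 1) ->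
   (forall t : R, 0 < t -> derivable W2 t 1 /\ derivable (derive1 W2) t 1) ->
   let W := fun t : R => alpha ^+ 2 *: W0 t + alpha *: derive1 W1 t
                     + derive1 (derive1 W2) t in
   forall t : R, 0 < t ->
     is_derive t 1 Theta
       (alpha *: (fbar (Theta t) - alpha *: avg P Om (Ups (Theta t)) + W t))).
Proof.
move=> _ _ _ _ powG Cf _ _ Om G fbar Cfbar Ups solf solfh solU Cfh Cfhh CUh Phi
  dTheta fh_t Y.
have cG : continuous (fun s => G (Phi s)) by exact: Gsig_clock_continuous.
have cf th : continuous (fun s => f th (G (Phi s))).
  move=> s; apply: (@continuous_comp _ _ _ (fun s => G (Phi s)) (f th)); first exact: cG.
  exact: (C1_continuous _ _ _ _ (C1_section _ _ _ _ _ th Cf)).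
have cont_clock (h : 'rV[R]_d -> CK R K -> 'rV[R]_d) th :
    C1_Pi Om h -> continuous (fun s => h th (Phi s)).
  move=> [ch _] s.
  apply: (@continuous_comp _ _ _ (fun s : R => (th, s))
    (fun p => h p.1 (Phi p.2)) s); last exact: cont_Pi_clock ch _.
  exact: continuous_cst_pair.
have cUps th : continuous (fun s => Ups th (Phi s)).
  move=> s.
  exact: (cvgN (C1_Pi_derive_continuous om ph fh th _ Cfh (cf th) s)).
have dir h t : C1_Pi Om h ->
    'D_(alpha *: f (Theta t) (G (Phi t))) (fun th => h th (Phi t)) (Theta t) =
    alpha *: Df f G h (Theta t) (Phi t).
  by move=> Ch; rewrite (C1_deriveZ _ _ _ _ _ _ _ (C1_Pi_C1 om ph h t Ch)).
have dfh (t : R) : 0 < t -> is_derive t 1 fh_t (alpha *: Df f G fh (Theta t) (Phi t) +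
    (fbar (Theta t) - f (Theta t) (G (Phi t)))).
  move=> t0; rewrite -dir //.
  exact: (poisson_sol_chain _ _ _ _ _ _ _ _ solf Cfh cf t0 (dTheta t t0)).
split=> [t t0|W0 W1 W2 dW1 dW2 W t t0].
  (* [C1_segment] is used with [a = alpha] and [v = fh_t t], since [Y t - alpha *: fh_t t] is
     [Theta t]. *)
  have fbarE : fbar (Theta t) = fbar (Y t) -
      alpha *: vint 0 1 (fun r => Abar fbar (Y t - (r * alpha) *: fh_t t) (fh_t t)).
    rewrite -C1_segment // subKr; congr fbar.
    by rewrite /Y addrK.
  rewrite [alpha *: (vint _ _ _ + _)]scalerDr opprD addrA -fbarE /Ups scalerN opprK.
  (* The term [f] in the derivative of [Theta] cancels against [- f] in that of [fh_t]. *)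
  have -> : alpha *: (fbar (Theta t) + alpha *: Df f G fh (Theta t) (Phi t)) =
      alpha *: f (Theta t) (G (Phi t)) +
      alpha *: (alpha *: Df f G fh (Theta t) (Phi t) +
        (fbar (Theta t) - f (Theta t) (G (Phi t)))).
    by rewrite -scalerDr addrCA [f _ _ + _]addrC subrK addrC.
  apply: is_deriveD; first exact: dTheta.
  by apply: is_deriveZ; exact: dfh.
have dW2E (s : R) : 0 < s ->
    W2^`()%classic s = alpha *: Df f G fhh (Theta s) (Phi s) - fh_t s.
  move=> s0; rewrite derive1E -dir //.
  have H := poisson_sol_chain _ _ _ _ _ _ _ _ solfh Cfhh
    (fun th => cont_clock _ th Cfh) s0 (dTheta s s0).
  rewrite (@derive_val _ _ _ _ _ _ _ H).
  (* The normalization of [fh] removes the mean of the forcing for [fhh]. *)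
  by rewrite solf.2 sub0r.
have dUh := poisson_sol_chain _ _ _ _ _ _ _ _ solU CUh cUps t0 (dTheta t t0).
(* The terms [Df fhh] of [alpha W1] and [W2'] cancel, which is why [W1] and [W2]
   are differentiated together. *)
have VE : \forall s \near t, alpha *: Uh (Theta s) (Phi s) - fh_t s =
    alpha *: W1 s + W2^`()%classic s.
  near=> s; rewrite dW2E; last by near: s; exact: lt_nbhsr.
  by rewrite /W1 scalerDr scalerN addrA; congr (_ - _); rewrite [RHS]addrC addNKr.
(* [V1] and [V2] differentiate one function twice: from the assumed differentiability of [W1] and of
   the derivative of [W2], then from the chain formulas for [Uh] and [fh]. [WE] equates the
   results. *)
have V1 : is_derive t 1 (fun s => alpha *: W1 s + W2^`()%classic s)
    (alpha *: W1^`()%classic t + W2^`()^`()%classic t).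
  apply: is_deriveD.
    by apply: is_deriveZ; rewrite derive1E; apply: DeriveDef => //; exact: dW1.
  by rewrite derive1E; apply: DeriveDef => //; exact: (dW2 t t0).2.
have V2 : is_derive t 1 (fun s => alpha *: W1 s + W2^`()%classic s)
    (alpha *: (alpha *: Df f G Uh (Theta t) (Phi t) +
       (avg P Om (Ups (Theta t)) - Ups (Theta t) (Phi t))) -
     (alpha *: Df f G fh (Theta t) (Phi t) +
       (fbar (Theta t) - f (Theta t) (G (Phi t))))).
  apply: (near_eq_is_derive VE); rewrite -dir //.
  exact: is_deriveB (is_deriveZ alpha dUh) (dfh t t0).
have WE : W t = alpha *: avg P Om (Ups (Theta t)) +
    (f (Theta t) (G (Phi t)) - fbar (Theta t)).
  rewrite /W -addrA -(@derive_val _ _ _ _ _ _ _ V1) (@derive_val _ _ _ _ _ _ _ V2).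
  rewrite /W0 [Ups (Theta t) (Phi t)]/Ups.
  move: (Df _ _ Uh _ _) (Df _ _ fh _ _) (avg _ _ _) (f _ _) (fbar _) => p q a x y.
  by apply/rowP => j; rewrite !mxE; ring.
(* With [WE] the bracket collapses to [f (Theta t) (G (Phi t))], so the claim is the original
   equation. *)
rewrite WE addrA subrK addrC subrK.
exact: dTheta.
Unshelve. all: by end_near. Qed.
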